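(* Let the system, constraints, cost, horizon $N\ge 1$ and functions $\rho$, $V_f$, $\lambda$ be as in the context, and suppose: (A1) the parameter set $\Theta$ is compact; (A2) the storage function $\lambda(\theta,x)$ is continuous on $\Theta\times\mathbb{X}$; (A3) the system is strictly controlled dissipative with respect to the supply rate $s(x,u)=\ell(x,u)-\ell(x^s,u^s)$: for all $\theta\in\Theta$ and all $x\in\mathbb{X}$ there exist $\theta^+\in\Theta$ and $u\in\mathbb{U}$ with $(x,u)\in\mathbb{Z}$ such that $$\lambda(\theta^+,f(x,u))-\lambda(\theta,x)\le\ell(x,u)-\ell(x^s,u^s)-\rho(x-x^s);$$ (A4) there exist a compact terminal region $\mathbb{X}_f\subseteq\mathbb{X}$ with $x^s$ as an interior point, a terminal policy $\kappa_f:\mathbb{X}\to\mathbb{U}$ with $\kappa_f(x^s)=u^s$, and a continuous terminal penalty $V_f:\mathbb{X}_f\to\mathbb{R}$ (these $\mathbb{X}_f$ and $V_f$ are the ones used in the optimisation problem), such that for all $x\in\mathbb{X}_f$: (i) $(x,\kappa_f(x))\in\mathbb{Z}$; (ii) $f(x,\kappa_f(x))\in\mathbb{X}_f$; (iii) $V_f(f(x,\kappa_f(x)))-V_f(x)\le\ell(x^s,u^s)-\ell(x,\kappa_f(x))$; (A5) for all $x\in\mathbb{X}_f$ and all $\theta\in\Theta$ there exists $\theta^+\in\Theta$ such that $$\lambda(\theta^+,f(x,\kappa_f(x)))-\lambda(\theta,x)\le \ell(x,\kappa_f(x))-\ell(x^s,u^s)-\rho(x-x^s).$$ Then the solution of the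 EMPC closed-loop system $x_{t+1}=f(x_t,u^*_{t|t})$ with initial condition $(x_0,\theta_0)\in\mathcal{X}_N$ asymptotically converges to $x^s$, i.e. $\lim_{t\to\infty}x_t=x^s$.
   Context: System: $x_{t+1}=f(x_t,u_t)$ with state $x\in\mathbb{X}\subseteq\mathbb{R}^n$, input $u\in\mathbb{U}\subseteq\mathbb{R}^m$, and continuous $f:\mathbb{X}\times\mathbb{U}\to\mathbb{X}$. Constraints: $(x_t,u_t)\in\mathbb{Z}$ for all $t\ge0$, where $\mathbb{Z}\subseteq\mathbb{X}\times\mathbb{U}$ is compact. The stage cost $\ell:\mathbb{Z}\to\mathbb{R}$ is continuous. The optimal steady state is $(x^s,u^s)=\arg\min\{\ell(x,u)\mid (x,u)\in\mathbb{Z},\ x=f(x,u)\}$, assumed to exist and be unique. $\Theta$ is a set of (finite-dimensional real) parameters and $\lambda:\Theta\times\mathbb{X}\to\mathbb{R}$ is a parameter-varying storage function. $\rho:\mathbb{R}^n\to\mathbb{R}_{\ge0}$ is a fixed positive definite function: continuous, $\rho(0)=0$, $\rho(z)>0$ for $z\ne0$. EMPC optimisation problem $\mathcal{P}_N(x_t,\theta_t)$ at time $t$, with horizon $N\in\mathbb{Z}_{\ge1}$ (here $\mathbb{Z}_{\geq 1}$ denotes the positive integers): minimise $$J_N=\sum_{k=t}^{t+N-1}\ell(x_{k|t},u_{k|t})+V_f(x_{t+N|t})$$ over sequences $(\theta_{k|t})_{k=t}^{t+N}$, $(x_{k|t})_{k=t}^{t+N}$, $(u_{k|t})_{k=t}^{t+N-1}$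 subject to: $x_{t|t}=x_t$; $\theta_{t|t}=\theta_t$; for all $k=t,\dots,t+N-1$: $x_{k+1|t}=f(x_{k|t},u_{k|t})$, $(x_{k|t},u_{k|t})\in\mathbb{Z}$, and $$\lambda(\theta_{k+1|t},x_{k+1|t})-\lambda(\theta_{k|t},x_{k|t})+\rho(x_{k|t}-x^s)\le\ell(x_{k|t},u_{k|t})-\ell(x^s,u^s);$$ $\theta_{k|t}\in\Theta$ for $k=t,\dots,t+N$; and $x_{t+N|t}\in\mathbb{X}_f$. $\mathcal{X}_N$ is the set of $(x,\theta)\in\mathbb{X}\times\Theta$ for which $\mathcal{P}_N(x,\theta)$ has a feasible solution. Closed loop: at each time $t$ an optimal solution (marked by $*$) of $\mathcal{P}_N(x_t,\theta_t)$ is computed, and $x_{t+1}=f(x_t,u^*_{t|t})$, $\theta_{t+1}=\theta^*_{t+1|t}$. *)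

(* Defs.v *)
From mathcomp Require Import all_boot all_order all_algebra.
From mathcomp Require Import all_classical all_reals all_analysis.
Import Order.TTheory GRing.Theory Num.Theory.
Import numFieldNormedType.Exports.

Set Implicit Arguments.
Unset Strict Implicit.
Unset Printing Implicit Defensive.

Local Open Scope classical_set_scope.
Local Open Scope ring_scope.

Definition argmin (R : realType) (T : Type) (A : set T) (c : T -> R) : set T :=
  [set a | A a /\ forall b, A b -> c a <= c b].

(* The data of an economic MPC scheme on R^n x R^m with parameters in R^p.
   Maps defined only on a subset in the mathematical text (the dynamics on
   X x U, the stage cost on Z, the storage function on Theta x X, the terminal
   penalty on X_f) are total here; their values off the subset are arbitrary
   and carry no assumption. *)
Record empc (R : realType) (n m p : nat) := Empc {
  state_set      : set 'rV[R]_n;                 (* X *)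
  input_set      : set 'rV[R]_m;                 (* U *)
  constraint_set : set ('rV[R]_n * 'rV[R]_m);    (* Z *)
  dyn            : 'rV[R]_n * 'rV[R]_m -> 'rV[R]_n;   (* f *)
  stage_cost     : 'rV[R]_n * 'rV[R]_m -> R;     (* l *)
  steady_state   : 'rV[R]_n;                     (* x^s *)
  steady_input   : 'rV[R]_m;                     (* u^s *)
  param_set      : set 'rV[R]_p;                 (* Theta *)
  storage        : 'rV[R]_p * 'rV[R]_n -> R;     (* lambda *)
  rho            : 'rV[R]_n -> R;
  horizon        : nat;                          (* N *)
  terminal_set   : set 'rV[R]_n;                 (* X_f *)
  terminal_cost  : 'rV[R]_n -> R                 (* V_f *)
}.

(* s(x, u) = l(x, u) - l(x^s, u^s) *)
Definition supply_rate (R : realType) (n m p : nat) (S : empc R n m p)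
    (x : 'rV[R]_n) (u : 'rV[R]_m) : R :=
  stage_cost S (x, u) - stage_cost S (steady_state S, steady_input S).

Definition steady_pairs (R : realType) (n m p : nat) (S : empc R n m p) :
    set ('rV[R]_n * 'rV[R]_m) :=
  [set xu | constraint_set S xu /\ xu.1 = dyn S xu].

(* The decision variables, indexed by the prediction step j = k - t.  Only
   theta_0, ..., theta_N, x_0, ..., x_N and u_0, ..., u_(N-1) enter the
   constraints, the objective and the closed loop; later entries are free. *)
Record prediction (R : realType) (n m p : nat) := Prediction {
  pred_param : nat -> 'rV[R]_p;
  pred_state : nat -> 'rV[R]_n;
  pred_input : nat -> 'rV[R]_m
}.

Definition feasible (R : realType) (n m p : nat) (S : empc R n m p)
    (x : 'rV[R]_n) (theta : 'rV[R]_p) : set (prediction R n m p) :=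
  [set s |
    [/\ pred_state s 0%N = x,
        pred_param s 0%N = theta,
        forall k : nat, (k < horizon S)%N ->
          [/\ pred_state s k.+1 = dyn S (pred_state s k, pred_input s k),
              constraint_set S (pred_state s k, pred_input s k) &
              storage S (pred_param s k.+1, pred_state s k.+1)
                - storage S (pred_param s k, pred_state s k)
                + rho S (pred_state s k - steady_state S)
              <= stage_cost S (pred_state s k, pred_input s k)
                - stage_cost S (steady_state S, steady_input S)],
        forall k : nat, (k <= horizon S)%N -> param_set S (pred_param s k) &
        terminal_set S (pred_state s (horizon S))]].

Definition objective (R : realType) (n m p : nat) (S : empc R n m p)
    (s : prediction R n m p) : R :=
  \sum_(k < horizon S) stage_cost S (pred_state s k, pred_input s k)
  + terminal_cost S (pred_state s (horizon S)).

Definition optimal (R : realType) (n m p : nat) (S : empc R n m p)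
    (x : 'rV[R]_n) (theta : 'rV[R]_p) : set (prediction R n m p) :=
  argmin (feasible S x theta) (objective S).

(* calligraphic X_N *)
Definition feasible_set (R : realType) (n m p : nat) (S : empc R n m p) :
    set ('rV[R]_n * 'rV[R]_p) :=
  [set xt | [/\ state_set S xt.1, param_set S xt.2 &
                feasible S xt.1 xt.2 !=set0]].

(* Minimisers need not be unique: any one of them may be applied at each
   time. *)
Definition closed_loop (R : realType) (n m p : nat) (S : empc R n m p)
    (x0 : 'rV[R]_n) (theta0 : 'rV[R]_p)
    (x : nat -> 'rV[R]_n) (theta : nat -> 'rV[R]_p) : Prop :=
  [/\ x 0%N = x0, theta 0%N = theta0 &
      forall t : nat, exists s : prediction R n m p,
        [/\ optimal S (x t) (theta t) s,
            x t.+1 = dyn S (x t, pred_input s 0%N) &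
            theta t.+1 = pred_param s 1%N]].

(* Main.v *)
(* Let J_t be the optimal cost at time t.  Dropping the first step of the
   optimal prediction and appending kappa_f, with the parameter given by A5,
   yields a feasible candidate, so
     J_(t+1) - J_t <= l(x^s, u^s) - l(x_t, u_t).
   Adding the dissipation constraint at k = 0 cancels the stage costs: the
   function W_t = J_t + lambda(theta_t, x_t) satisfies
     rho(x_t - x^s) <= W_t - W_(t+1).
   Since W is bounded below, rho(x_t - x^s) is summable, hence tends to 0, and
   x_t -> x^s because the states stay in a compact set.
   Existence of minimisers and the lower bound on W both follow from the
   compactness of the set of triples (theta, x, c) such that c is the cost of
   a feasible prediction from (x, theta), proved by induction on the horizon:
   one more step is the continuous image of a relatively closed subset of
   Theta x Z x (the set for the shorter horizon). *)
Require Import Defs.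
From mathcomp Require Import all_boot all_order all_algebra.
From mathcomp Require Import all_classical all_reals all_analysis.
From mathcomp Require Import lra.
Import Order.TTheory GRing.Theory Num.Theory.
Import numFieldNormedType.Exports.
Local Open Scope classical_set_scope.
Local Open Scope ring_scope.

(** * Relative continuity, compactness and convergence criteria *)

Lemma within_continuous_comp_sub {T U V : topologicalType} (A : set T)
    (B : set U) (f : T -> U) (g : U -> V) :
  (forall x, A x -> B (f x)) -> {within A, continuous f} ->
  {within B, continuous g} -> {within A, continuous (g \o f)}.
Proof.
move=> AB /subspace_continuousP fc /subspace_continuousP gc.
apply/subspace_continuousP => x Ax.
apply: (@cvg_comp _ _ _ f g _ (within B (nbhs (f x)))); last first.
  exact: gc (AB _ Ax).
move=> D /(fc x Ax) /= fD; rewrite !nbhs_simpl /within /= in fD *.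
by apply: filterS fD => y yD Ay; apply: yD => //; exact: AB.
Qed.

Lemma within_continuous_pair {T U V : topologicalType} (A : set T)
    (f : T -> U) (g : T -> V) :
  {within A, continuous f} -> {within A, continuous g} ->
  {within A, continuous (fun x => (f x, g x))}.
Proof. by move=> fc gc x; exact: cvg_pair (fc x) (gc x). Qed.

(** Since [g] is continuous only relative to [K], the preimage of [C] need not be closed. Instead,
    the graph of [g] over [K] is compact; it is cut by the closed cylinder over [C] and projected
    back to [T]. *)
Lemma compact_setI_preimage {T U : topologicalType} (K : set T) (C : set U)
    (g : T -> U) :
  compact K -> {within K, continuous g} -> closed C ->
  compact (K `&` g @^-1` C).
Proof.
move=> Kc gc Cc; pose G := (fun x => (x, g x)) @` K `&` snd @^-1` C.
have -> : K `&` g @^-1` C = fst @` G.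
  apply/seteqP; split=> [x [Kx Cgx]|_ [_ [[x Kx <-] Cgx] <-]]; last by split.
  by exists (x, g x) => //; split=> //; exists x.
apply: continuous_compact.
  by apply: continuous_subspaceT => x; exact: cvg_fst.
apply: compact_closedI.
  apply: continuous_compact Kc; apply: within_continuous_pair gc.
  by apply: continuous_subspaceT => x; exact: cvg_id.
by apply: preimage_closed Cc => x _; exact: cvg_snd.
Qed.

(* Away from any open neighbourhood of [a], [K] is compact, so the values of
   [g] there omit a neighbourhood of 0. *)
Lemma compact_cvg_of_zero (R : realType) (T : topologicalType) (K : set T)
    (g : T -> R) (a : T) (x : nat -> T) :
  compact K -> continuous g -> (forall y, y <> a -> g y <> 0) ->
  (forall t, K (x t)) -> g \o x @ \oo --> (0 : R) -> x @ \oo --> a.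
Proof.
move=> Kc gc g0 Kx gx B; rewrite nbhsE => -[D [Do Da] DB].
pose C := g @` (K `&` ~` D).
have Cc : closed C.
  apply: compact_closed; first exact: Rhausdorff.
  apply: continuous_compact; first exact: continuous_subspaceT.
  by apply: compact_closedI => //; exact: open_closedC.
have C0 : nbhs (0 : R) (~` C).
  apply: open_nbhs_nbhs; split; first exact: closed_openC.
  by move=> [y [_ Dy]]; apply: g0 => ya; apply: Dy; rewrite ya.
move: (gx _ C0); rewrite !nbhs_simpl /=; apply: filterS => t /= Ct.
by apply: DB; apply: contrapT => Dt; apply: Ct; exists (x t).
Qed.

(** Telescoping bounds the partial sums of [u] by [w 0 - b], so this series of nonnegative terms
    converges. *)
Lemma cvg0_of_sum_le (R : realType) (u w : R ^nat) (b : R) :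
  (forall t, 0 <= u t) -> (forall t, b <= w t) ->
  (forall t, u t <= w t - w t.+1) -> u @ \oo --> (0 : R).
Proof.
move=> u0 wb uw; apply: cvg_series_cvg_0; apply: nondecreasing_is_cvgn.
  by apply: nondecreasing_series => t _ _; exact: u0.
exists (w 0%N - b) => _ [t _ <-].
apply: (@le_trans _ _ (w 0%N - w t)); last by rewrite lerD2l lerN2.
rewrite /series /=; elim: t => [|t IH]; first by rewrite big_geq // subrr.
rewrite big_nat_recr //=; move: IH (uw t).
by move=> IH /(lerD IH); rewrite addrA subrK.
Qed.

(** * Recursion on the horizon for the set of attainable costs *)

Section empc_theory.
Context {R : realType} {n m p : nat}.
Implicit Types (S : empc R n m p) (s : prediction R n m p).

(** Frees the horizon for induction while the other data stay fixed. *)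
Definition with_horizon S (k : nat) : empc R n m p :=
  Empc (state_set S) (input_set S) (constraint_set S) (dyn S) (stage_cost S)
    (steady_state S) (steady_input S) (param_set S) (storage S) (rho S) k
    (terminal_set S) (terminal_cost S).

Lemma with_horizon_id S : with_horizon S (horizon S) = S.
Proof. by case: S. Qed.

(** All attainable costs are recorded, not only optimal ones: a minimiser is a lowest point of the
    fibre over a pair. The parameter comes first so that [q.1] is an argument of [storage]. *)
Definition cost_graph S : set ('rV[R]_p * 'rV[R]_n * R) :=
  [set q | exists2 s, feasible S q.1.2 q.1.1 s & objective S s = q.2].

(* (theta, (x, u), (theta', x', c)), with c the cost of a prediction from
   (theta', x'). *)
Local Notation step :=
  ('rV[R]_p * ('rV[R]_n * 'rV[R]_m) * ('rV[R]_p * 'rV[R]_n * R))%type.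

(** Comparison with 0 exhibits this as the preimage of a closed set; the membership constraints are
    left to a compact product. *)
Definition admissible_step S (z : step) :=
  dyn S z.1.2 - z.2.1.2 = 0 /\
  0 <= stage_cost S z.1.2 - stage_cost S (steady_state S, steady_input S)
       - (storage S z.2.1 - storage S (z.1.1, z.1.2.1)
          + rho S (z.1.2.1 - steady_state S)).

Definition prepend (a : 'rV[R]_p) (xu : 'rV[R]_n * 'rV[R]_m) s :=
  Prediction (fun k => if k is k'.+1 then pred_param s k' else a)
    (fun k => if k is k'.+1 then pred_state s k' else xu.1)
    (fun k => if k is k'.+1 then pred_input s k' else xu.2).

Definition behead_prediction s :=
  Prediction (pred_param s \o S) (pred_state s \o S) (pred_input s \o S).

Lemma cost_graph0 S : cost_graph (with_horizon S 0) =
  (fun q => (q, terminal_cost S q.2)) @` (param_set S `*` terminal_set S).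
Proof.
apply/seteqP; split=> [[[a x] c] [s [/= sx sa _ sT sX] /= <-]|].
  exists (a, x) => /=.
    by split=> /=; [rewrite -sa; exact: sT|rewrite -sx].
  by rewrite /objective /= big_ord0 add0r sx.
move=> _ [[a x] [/= Ta Xx] <-].
exists (Prediction (fun=> a) (fun=> x) (fun=> 0)); first by split.
by rewrite /objective /= big_ord0 add0r.
Qed.

(** A prediction is a first step followed by a tail: [behead_prediction] gives one inclusion,
    [prepend] the other. *)
Lemma cost_graphS S k : cost_graph (with_horizon S k.+1) =
  (fun z => (z.1.1, z.1.2.1, stage_cost S z.1.2 + z.2.2)) @`
    ((param_set S `*` constraint_set S) `*` cost_graph (with_horizon S k)
     `&` admissible_step S).
Proof.
apply/seteqP; split=> [[[a x] c] [s [/= sx sa sD sT sX] /= <-]|].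
  have [d0 z0 l0] := sD 0%N isT.
  exists (a, (x, pred_input s 0%N), (pred_param s 1%N, pred_state s 1%N,
    objective (with_horizon S k) (behead_prediction s))) => /=; last first.
    by rewrite /objective /= big_ord_recl /= sx addrA.
  split; last by split; rewrite /= -sx ?subr_ge0 -?sa // d0 subrr.
  split=> /=; first by split=> /=; [rewrite -sa; exact: sT|rewrite -sx].
  exists (behead_prediction s) => //; split=> //= j jk; first exact: (sD j.+1).
  exact: (sT j.+1).
move=> _ [[[a [x u]] [[b y] c]] [[[/= Ta Zx] G] H] <-].
move: G H => [s [/= sy sb sD sT sX] /= <-] [/= /eqP].
rewrite subr_eq0 subr_ge0 => /eqP dyn_y l0.
exists (prepend a (x, u) s); last first.
  by rewrite /objective /= big_ord_recl /= addrA.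
split=> //= [[_|j jk]|[|j] jk] //; [|exact: sD|exact: sT].
by rewrite sy sb dyn_y.
Qed.

(** * Compactness, existence of minimisers and the lower bound *)

Section regular.
Variable S : empc R n m p.
Hypotheses (f_cont : {within state_set S `*` input_set S, continuous (dyn S)})
  (Z_sub : constraint_set S `<=` state_set S `*` input_set S)
  (Z_compact : compact (constraint_set S))
  (l_cont : {within constraint_set S, continuous (stage_cost S)})
  (rho_cont : continuous (rho S))
  (Theta_compact : compact (param_set S))
  (lambda_cont : {within param_set S `*` state_set S, continuous (storage S)})
  (Xf_compact : compact (terminal_set S))
  (Xf_sub : terminal_set S `<=` state_set S)
  (Vf_cont : {within terminal_set S, continuous (terminal_cost S)}).

(** Places the pairs where [storage] is continuous. The state is in X by [Xf_sub] at horizon 0, and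
    by [Z_sub] at the first step otherwise. *)
Lemma cost_graph_dom k q : cost_graph (with_horizon S k) q ->
  (param_set S `*` state_set S) q.1.
Proof.
case: q => -[a x] c [s [/= sx sa sD sT sX] _]; split=> /=.
  by rewrite -sa; exact: sT.
rewrite -sx; case: k sD sT sX => [|k] sD sT sX; first exact: Xf_sub.
by have [_ /Z_sub[]] := sD 0%N isT.
Qed.

Lemma cost_graph_compact k : compact (cost_graph (with_horizon S k)).
Proof.
elim: k => [|k IH].
  rewrite cost_graph0; apply: continuous_compact; last exact: compact_setX.
  apply: within_continuous_pair.
    by apply: continuous_subspaceT => x; exact: cvg_id.
  apply: (within_continuous_comp_sub _ (terminal_set S)) => //.
    by move=> x [].
  by apply: continuous_subspaceT => x; exact: cvg_snd.
(* On [K] the maps [dyn], [stage_cost] and [storage] are evaluated only where they are assumed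
   continuous. *)
set K := (param_set S `*` constraint_set S) `*` cost_graph (with_horizon S k).
have Kc : compact K by do !apply: compact_setX.
have c11 : continuous (fun z : step => z.1.1).
  by move=> z; apply: cvg_comp cvg_fst _; exact: cvg_fst.
have c12 : continuous (fun z : step => z.1.2).
  by move=> z; apply: cvg_comp cvg_fst _; exact: cvg_snd.
have c21 : continuous (fun z : step => z.2.1).
  by move=> z; apply: cvg_comp cvg_snd _; exact: cvg_fst.
have c121 : continuous (fun z : step => z.1.2.1).
  by move=> z; apply: cvg_comp (c12 z) _; exact: cvg_fst.
have c212 : continuous (fun z : step => z.2.1.2).
  by move=> z; apply: cvg_comp (c21 z) _; exact: cvg_snd.
have c22 : continuous (fun z : step => z.2.2).
  by move=> z; apply: cvg_comp cvg_snd _; exact: cvg_snd.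
have lK : {within K, continuous (fun z => stage_cost S z.1.2)}.
  apply: (within_continuous_comp_sub _ (constraint_set S)
    (fun z => z.1.2)) => //; first by move=> z [[]].
  exact: continuous_subspaceT.
have fK : {within K, continuous (fun z => dyn S z.1.2)}.
  apply: (within_continuous_comp_sub _ (state_set S `*` input_set S)
    (fun z => z.1.2)) => //; first by move=> z [[_ /Z_sub]].
  exact: continuous_subspaceT.
have sK : {within K, continuous (fun z => storage S z.2.1)}.
  apply: (within_continuous_comp_sub _ (param_set S `*` state_set S)
    (fun z => z.2.1)) => //; first by move=> z [_ /cost_graph_dom].
  exact: continuous_subspaceT.
have s'K : {within K, continuous (fun z => storage S (z.1.1, z.1.2.1))}.
  apply: (within_continuous_comp_sub _ (param_set S `*` state_set S)
    (fun z => (z.1.1, z.1.2.1))) => //.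
    by move=> z [[z1 /Z_sub[]]].
  by apply: continuous_subspaceT => z; exact: cvg_pair (c11 z) (c121 z).
have rK : {within K, continuous (fun z => rho S (z.1.2.1 - steady_state S))}.
  apply: continuous_subspaceT => z.
  apply: (cvg_comp (fun z => z.1.2.1 - steady_state S) (rho S) _ (rho_cont _)).
  by apply: cvgB; [exact: c121|exact: cvg_cst].
rewrite cost_graphS -/K; apply: continuous_compact.
  apply: (continuous_subspaceW (@subIsetl _ K _)).
  apply: within_continuous_pair.
    by apply: continuous_subspaceT => z; exact: cvg_pair (c11 z) (c121 z).
  move=> z; apply: cvgD; first exact: lK.
  exact: (continuous_subspaceT c22).
pose g1 (z : step) :=
  dyn S z.1.2 - z.2.1.2.
pose g2 (z : step) :=
  stage_cost S z.1.2 - stage_cost S (steady_state S, steady_input S)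
       - (storage S z.2.1 - storage S (z.1.1, z.1.2.1)
          + rho S (z.1.2.1 - steady_state S)).
have -> : K `&` admissible_step S =
    K `&` (fun z => (g1 z, g2 z)) @^-1`
      (fst @^-1` [set 0] `&` snd @^-1` [set y | 0 <= y]).
  by [].
apply: compact_setI_preimage => //.
  apply: within_continuous_pair => z.
    by apply: cvgB; [exact: fK|exact: (continuous_subspaceT c212)].
  apply: cvgB.
    by apply: cvgB; [exact: lK|exact: cvg_cst].
  by apply: cvgD; [apply: cvgB; [exact: sK|exact: s'K]|exact: rK].
apply: closedI; apply: preimage_closed.
- by move=> y _; exact: cvg_fst.
- by apply: compact_closed; [exact: norm_hausdorff|exact: compact_set1].
- by move=> y _; exact: cvg_snd.
- exact: closed_ge.
Qed.

Lemma optimal_exists x a : feasible S x a !=set0 -> optimal S x a !=set0.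
Proof.
move=> [s0 s0F].
(* The fibre over [(a, x)]: its point of least cost comes from an optimal prediction. *)
pose G := cost_graph S `&` fst @^-1` [set (a, x)].
have Gc : compact G.
  apply: compact_closedI.
    by rewrite -(with_horizon_id S); exact: cost_graph_compact.
  apply: preimage_closed => [q _|]; first exact: cvg_fst.
  apply: compact_closed; last exact: compact_set1.
  exact: norm_hausdorff.
have G0 : G !=set0 by exists (a, x, objective S s0); split=> //; exists s0.
have [|q] := @compact_EVT_min _ _ snd G G0 Gc.
  by apply: continuous_subspaceT => q; exact: cvg_snd.
rewrite inE => -[[s sF sq] /= qax] qmin; rewrite qax in sF.
exists s; split=> // s' s'F; rewrite sq.
by apply: (qmin (a, x, objective S s')); rewrite inE; split=> //; exists s'.
Qed.

(** One bound serves all pairs, because cost plus storage is continuous on the compact cost graph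
    and attains its minimum there. *)
Lemma lyapunov_lbound : exists b, forall x a s, feasible S x a s ->
  b <= objective S s + storage S (a, x).
Proof.
have [[q0 Gq0]|G0] := pselect (cost_graph S !=set0); last first.
  exists 0 => x a s sF; exfalso; apply: G0.
  by exists (a, x, objective S s); exists s.
have Gc : compact (cost_graph S).
  by rewrite -(with_horizon_id S); exact: cost_graph_compact.
have [||q _ qmin] := @compact_EVT_min _ _ (fun q => q.2 + storage S q.1) _ _ Gc.
- by exists q0.
- move=> z; apply: cvgD.
    by apply: (@continuous_subspaceT _ _ _ snd) => q; exact: cvg_snd.
  apply: (within_continuous_comp_sub _ (param_set S `*` state_set S)
    fst) => //.
    move=> q; rewrite -{1}(with_horizon_id S); exact: cost_graph_dom.
  by apply: continuous_subspaceT => q; exact: cvg_fst.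
exists (q.2 + storage S q.1) => x a s sF.
by apply: (qmin (a, x, objective S s)); rewrite inE; exists s.
Qed.

End regular.

(** * Feasibility and cost of the shifted candidate *)

Section shifted_prediction.
Variables (S : empc R n m p) (kappa_f : 'rV[R]_n -> 'rV[R]_m).
Hypotheses (N_ge1 : (1 <= horizon S)%N)
  (terminal : forall x, terminal_set S x ->
     [/\ constraint_set S (x, kappa_f x),
         terminal_set S (dyn S (x, kappa_f x)) &
         terminal_cost S (dyn S (x, kappa_f x)) - terminal_cost S x
         <= stage_cost S (steady_state S, steady_input S)
            - stage_cost S (x, kappa_f x)])
  (terminal_dissipative : forall x theta,
     terminal_set S x -> param_set S theta ->
     exists2 theta', param_set S theta' &
       storage S (theta', dyn S (x, kappa_f x)) - storage S (theta, x)
       <= supply_rate S x (kappa_f x) - rho S (x - steady_state S)).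

Lemma shifted_prediction x a s : feasible S x a s ->
  exists2 s', feasible S (dyn S (x, pred_input s 0%N)) (pred_param s 1%N) s' &
    objective S s' <= objective S s
      - (stage_cost S (x, pred_input s 0%N)
         - stage_cost S (steady_state S, steady_input S)).
Proof.
rewrite /feasible /objective; case: (horizon S) N_ge1 => // N _.
move=> [sx sa sD sT sX]; have [d0 _ _] := sD 0%N isT.
have [Zf Xf Vf] := terminal _ sX.
have [b Tb lb] := terminal_dissipative _ _ sX (sT N.+1 (leqnn _)).
set y := pred_state s N.+1 in Zf Xf Vf lb.
(* The horizon is now [N.+1]. Shifted states and parameters last through index [N], where the state
   is the old terminal state [y]; shifted inputs run out one index earlier, so [kappa_f y] acts at
   [N]. *)
pose s' := Prediction
  (fun k => if (k <= N)%N then pred_param s k.+1 else b)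
  (fun k => if (k <= N)%N then pred_state s k.+1 else dyn S (y, kappa_f y))
  (fun k => if (k < N)%N then pred_input s k.+1 else kappa_f y).
exists s'.
  split=> /=; rewrite ?ltnn -?sx //.
  - move=> k kN1; have [kN|Nk] := ltnP k N.
      rewrite (ltnW kN); exact: (sD k.+1).
    (* The appended step, admissible by [Zf] and [lb]. *)
    have -> : k = N by apply/eqP; rewrite eqn_leq Nk -ltnS kN1.
    by rewrite leqnn; split=> //; rewrite -lerBrDr.
  - by move=> k _; case: leqP => // kN; exact: (sT k.+1).
(* With the appended stage split off the new sum and the first stage off the old one, the other [N]
   terms agree; [Vf] controls the appended stage and the change of terminal cost. *)
rewrite /= ltnn big_ord_recr [in leRHS]big_ord_recl /= leqnn ltnn sx.
have -> : \sum_(i < N) stage_cost S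
    (if (i <= N)%N then pred_state s i.+1 else dyn S (y, kappa_f y),
     if (i < N)%N then pred_input s i.+1 else kappa_f y) =
    \sum_(i < N)
      stage_cost S (pred_state s (bump 0 i), pred_input s (bump 0 i)).
  by apply: eq_bigr => i _; rewrite ltn_ord (ltnW (ltn_ord i)).
rewrite -/y; move: Vf; lra.
Qed.

End shifted_prediction.
End empc_theory.

(** * Existence and convergence of closed-loop trajectories *)

Theorem theorem11 (R : realType) (n m p : nat) (S : empc R n m p)
  (kappa_f : 'rV[R]_n -> 'rV[R]_m)
  (* standing assumptions on the system, constraints, cost, rho and N *)
  (f_maps : forall x u, state_set S x -> input_set S u ->
     state_set S (dyn S (x, u)))
  (f_cont : {within state_set S `*` input_set S, continuous (dyn S)})
  (Z_sub : constraint_set S `<=` state_set S `*` input_set S)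
  (Z_compact : compact (constraint_set S))
  (l_cont : {within constraint_set S, continuous (stage_cost S)})
  (steady_opt : argmin (steady_pairs S) (stage_cost S)
     = [set (steady_state S, steady_input S)])
  (rho_cont : continuous (rho S))
  (rho0 : rho S 0 = 0)
  (rho_pos : forall z, z <> 0 -> 0 < rho S z)
  (N_ge1 : (1 <= horizon S)%N)
  (* A1 *)
  (Theta_compact : compact (param_set S))
  (* A2 *)
  (lambda_cont : {within param_set S `*` state_set S, continuous (storage S)})
  (* A3 *)
  (dissipative : forall theta x, param_set S theta -> state_set S x ->
     exists theta' u, [/\ param_set S theta', input_set S u,
       constraint_set S (x, u) &
       storage S (theta', dyn S (x, u)) - storage S (theta, x)
       <= supply_rate S x u - rho S (x - steady_state S)])
  (* A4 *)
  (Xf_compact : compact (terminal_set S))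
  (Xf_sub : terminal_set S `<=` state_set S)
  (xs_interior : interior (terminal_set S) (steady_state S))
  (kappa_f_maps : forall x, state_set S x -> input_set S (kappa_f x))
  (kappa_f_steady : kappa_f (steady_state S) = steady_input S)
  (Vf_cont : {within terminal_set S, continuous (terminal_cost S)})
  (terminal : forall x, terminal_set S x ->
     [/\ constraint_set S (x, kappa_f x),
         terminal_set S (dyn S (x, kappa_f x)) &
         terminal_cost S (dyn S (x, kappa_f x)) - terminal_cost S x
         <= stage_cost S (steady_state S, steady_input S)
            - stage_cost S (x, kappa_f x)])
  (* A5 *)
  (terminal_dissipative : forall x theta,
     terminal_set S x -> param_set S theta ->
     exists2 theta', param_set S theta' &
       storage S (theta', dyn S (x, kappa_f x)) - storage S (theta, x)
       <= supply_rate S x (kappa_f x) - rho S (x - steady_state S)) :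
  forall (x0 : 'rV[R]_n) (theta0 : 'rV[R]_p), feasible_set S (x0, theta0) ->
    (exists x theta, closed_loop S x0 theta0 x theta) /\
    (forall x theta, closed_loop S x0 theta0 x theta ->
       x @ \oo --> steady_state S).
Proof.
move=> x0 theta0 [/= _ _ feas0].
have opt := optimal_exists S f_cont Z_sub Z_compact l_cont rho_cont
  Theta_compact lambda_cont Xf_compact Xf_sub Vf_cont.
have shift := shifted_prediction S kappa_f N_ge1 terminal terminal_dissipative.
have [b Wb] := lyapunov_lbound S f_cont Z_sub Z_compact l_cont rho_cont
  Theta_compact lambda_cont Xf_compact Xf_sub Vf_cont.
split.
  (* Keeping feasibility as a premise makes the selection [g] total; a zero prediction fills the
     infeasible pairs. *)
  have /choice[g gP] : forall q : 'rV[R]_n * 'rV[R]_p, exists s,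
      feasible S q.1 q.2 !=set0 -> optimal S q.1 q.2 s.
    move=> q; have [/opt[s sopt]|F0] := pselect (feasible S q.1 q.2 !=set0).
      by exists s.
    by exists (Prediction (fun=> 0) (fun=> 0) (fun=> 0)) => /F0.
  pose next q := (dyn S (q.1, pred_input (g q) 0%N), pred_param (g q) 1%N).
  pose q t := iter t next (x0, theta0).
  (* Recursive feasibility, witnessed by the shifted candidate. *)
  have qF t : feasible S (q t).1 (q t).2 !=set0.
    elim: t => [//|t IH]; have [sF _] := gP _ IH.
    by have [s' s'F _] := shift _ _ _ sF; exists s'.
  exists (fst \o q), (snd \o q); split=> // t.
  by exists (g (q t)); split=> //; exact: gP.
move=> x theta [_ _ /choice[s sP]].
have sF t : feasible S (x t) (theta t) (s t) by have [[]] := sP t.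
pose W t := objective S (s t) + storage S (theta t, x t).
(* The compact set containing all [x t] is the projection of Z to the states. *)
apply: (@compact_cvg_of_zero _ _ (fst @` constraint_set S)
    (fun y => rho S (y - steady_state S))).
- apply: continuous_compact => //.
  by apply: continuous_subspaceT => q; exact: cvg_fst.
- move=> y.
  apply: (cvg_comp (fun y => y - steady_state S) (rho S) _ (rho_cont _)).
  by apply: (cvgB (@cvg_id _ (nbhs y))); exact: cvg_cst.
- move=> y yxs; apply/eqP; rewrite gt_eqF // rho_pos // => /eqP.
  by rewrite subr_eq0 => /eqP.
- move=> t; have [sx _ sD _ _] := sF t; have [_ Zt _] := sD 0%N N_ge1.
  by exists (x t, pred_input (s t) 0%N) => //; rewrite -{1}sx.
apply: (@cvg0_of_sum_le _ _ W b) => t /=.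
- have [->|/eqP yxs] := eqVneq (x t - steady_state S) 0; first by rewrite rho0.
  by rewrite ltW // rho_pos.
- exact: Wb.
have [sx sa sD _ _] := sF t; have [d0 _ l0] := sD 0%N N_ge1.
have [_ xS thetaS] := sP t; have [s' s'F s'le] := shift _ _ _ (sF t).
rewrite -xS -thetaS in s'F.
(* The optimal cost at [t.+1] is at most that of the candidate [s'] built from the optimum at
   [t]. *)
have [[_ /(_ _ s'F) sopt] _ _] := sP t.+1.
rewrite d0 sx sa -xS -thetaS in l0.
rewrite /W; lra.
Qed.
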